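(* Let $N\ge 2$ and let $\{T^{(n)}\}_{n\in\mathbb N}$ be a sequence of $N\times N$ stochastic matrices with positive entries such that $$\sum_{n=1}^\infty\left|\frac{T^{(n)}_{x_n,x_{n+1}}}{T^{(n+1)}_{x_n,x_{n+1}}}-1\right|<\infty\quad\text{for all }x_1x_2\dots\in\mathcal K_N.$$ Let $T^{(\infty)}$ be the limit of the sequence $T^{(n)}$ (which exists and is a stochastic matrix with positive entries). Let $v=(v_0,\dots,v_{N-1})$ be the Perron-Frobenius positive probability eigenvector for $T^{(\infty)}$, i.e., $vT^{(\infty)}=v$, $v_i>0$ for $i\in\mathbb Z_N$, and $\sum_{i\in\mathbb Z_N}v_i=1$. Let $Q$ be the $N\times N$ matrix all of whose rows are equal to $v$. Then, for all $p\ge 1$, $$\lim_{n\to\infty}T^{(p+1)}T^{(p+2)}\cdots T^{(n)}=Q.$$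
   Context: $\mathbb N=\{1,2,\dots\}$, $\mathbb Z_N=\{0,1,\dots,N-1\}$, and $\mathcal K_N=\mathbb Z_N^{\mathbb N}$ is the set of all infinite words $x_1x_2\dots$ with letters in $\mathbb Z_N$. An $N\times N$ matrix, with rows and columns indexed by $\mathbb Z_N$, is stochastic if the sum of the entries in each row is $1$. Row vectors multiply matrices on the left. Convergence of matrices is entrywise. *)

(* Defs.v *)
From HB Require Import structures.
From mathcomp Require Import all_boot all_order all_algebra.
From mathcomp Require Import all_classical all_reals all_analysis.

Set Implicit Arguments.
Unset Strict Implicit.
Unset Printing Implicit Defensive.

Import Order.TTheory GRing.Theory Num.Theory.
Import numFieldNormedType.Exports.

Local Open Scope classical_set_scope.
Local Open Scope ring_scope.

(* Only the row sums are constrained: nonnegativity is not part of the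
   definition, positivity is always required separately. *)
Definition stochastic (R : realType) (N : nat) (A : 'M[R]_N) : Prop :=
  forall i, \sum_j A i j = 1.

Definition positive_entries (R : realType) (m n : nat) (A : 'M[R]_(m, n)) : Prop :=
  forall i j, 0 < A i j.

Definition mx_cvg (R : realType) (m n : nat) (A : nat -> 'M[R]_(m, n))
    (B : 'M[R]_(m, n)) : Prop :=
  forall i j, A k i j @[k --> \oo] --> B i j.

Definition perron_vector (R : realType) (N : nat) (A : 'M[R]_N)
    (v : 'rV[R]_N) : Prop :=
  [/\ v *m A = v, positive_entries v & \sum_i v 0 i = 1].

Definition rows_equal_to (R : realType) (N : nat) (v : 'rV[R]_N) : 'M[R]_N :=
  \matrix_(i, j) v 0 j.

(* Main.v *)
Require Import Defs.
From HB Require Import structures.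
From mathcomp Require Import all_boot all_order all_algebra.
From mathcomp Require Import all_classical all_reals all_analysis.
From mathcomp Require Import lra.
Set Implicit Arguments.
Unset Strict Implicit.
Unset Printing Implicit Defensive.
Import Order.TTheory GRing.Theory Num.Theory.
Import numFieldNormedType.Exports.
Local Open Scope classical_set_scope.
Local Open Scope ring_scope.

(* Each entry (i, j) satisfies a summability condition on T n i j / T n.+1 i j - 1,
   obtained by adding the conditions for the words ijij... and jiji...; hence the
   entries converge and stay above some d > 0.  A stochastic matrix with entries at
   least d contracts the l1 norm of row vectors of sum 0 by the factor 1 - N d.  This
   gives existence, positivity and uniqueness of v, and, applied to r_n - v for r_n a
   row of the partial product, the convergence of the products through
   r_(n+1) - v = (r_n - v) T_(n+1) + v (T_(n+1) - Tinf), whose last term tends to 0. *)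

(** * Convergence of real sequences *)

Lemma contraction_cvg0 (R : realType) (c : R) (a e : nat -> R) :
  0 <= c < 1 -> (forall n, 0 <= a n) -> (forall n, a n.+1 <= c * a n + e n) ->
  e @ \oo --> 0 -> a @ \oo --> 0.
Proof.
move=> /andP[c0 c1] a0 ae e0; apply/cvgr0Pnorm_le => eps eps0.
have d0 : 0 < (1 - c) * (eps / 2) by rewrite mulr_gt0 ?subr_gt0 ?divr_gt0.
have [m _ em] := (cvgr0Pnorm_le e).1 e0 _ d0.
(* The level [eps / 2] is the fixed point of [t |-> c * t + (1 - c) * (eps / 2)], so past [m] the
   excess over it shrinks by the factor [c] at each step. *)
have step k : a (k + m)%N <= eps / 2 + c ^+ k * a m.
  elim: k => [|k IHk]; first by rewrite expr0 mul1r lerDr ltW ?divr_gt0.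
  have ek : e (k + m)%N <= (1 - c) * (eps / 2).
    by apply: le_trans (ler_norm _) _; apply: em => /=; rewrite leq_addl.
  rewrite addSn (le_trans (ae _))// (le_trans (lerD (ler_wpM2l c0 IHk) ek))//.
  by rewrite exprS; lra.
have geo : geometric (a m) c @ \oo --> 0 by apply: cvg_geometric; rewrite ger0_norm.
have [k _ ck] := (cvgr0Pnorm_le _).1 geo _ (divr_gt0 eps0 (ltr0Sn R 1)).
exists (k + m)%N => // n /= kmn; rewrite ger0_norm//.
have mn : (m <= n)%N by apply: leq_trans kmn; rewrite leq_addl.
rewrite -(subnK mn) (le_trans (step _))// [leRHS]splitr lerD2l.
apply: le_trans (ck (n - m)%N _); last by rewrite /= leq_subRL// addnC.
by rewrite /geometric/= mulrC ler_norm.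
Qed.

(** The increments of [u] are at most [B] times the summands, so the telescoping series converges
    absolutely. The lower bound, which keeps the limit away from 0, comes from multiplying the
    ratios [u k / u k.+1], each at most the exponential of its summand. *)
Lemma cvg_summable_ratio (R : realType) (u : nat -> R) (B M : R) :
  (forall n, 0 < u n <= B) ->
  (forall n, \sum_(0 <= k < n) `|u k / u k.+1 - 1| <= M) ->
  cvgn u /\ forall n, u 0%N * expR (- M) <= u n.
Proof.
move=> uB uM.
have u0 n : 0 < u n by case/andP: (uB n).
have B0 : 0 < B by case/andP: (uB 0%N) => /lt_le_trans; apply.
have uE k : u k - u k.+1 = (u k / u k.+1 - 1) * u k.+1.
  by rewrite mulrBl divfK ?gt_eqF// mul1r.
split.
  have uts : u = (fun n => u 0%N + series (telescope u) n).
    by apply/funext => n; rewrite -eq_sum_telescope.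
  rewrite uts; apply: is_cvgD; first exact: is_cvg_cst.
  apply: normed_cvg; apply: nondecreasing_is_cvgn.
    by apply: nondecreasing_series => n _ _ /=.
  exists (B * M) => _ [n _ <-]; rewrite /= /series/=.
  apply: (@le_trans _ _ (\sum_(0 <= k < n) B * `|u k / u k.+1 - 1|)).
    apply: ler_sum => k _; rewrite /telescope distrC uE normrM mulrC.
    by rewrite ler_wpM2r// gtr0_norm//; case/andP: (uB k.+1).
  by rewrite -mulr_sumr ler_wpM2l// ltW.
move=> n; rewrite expRN ler_pdivrMr ?expR_gt0//.
apply: (@le_trans _ _ (u n * expR (\sum_(0 <= k < n) `|u k / u k.+1 - 1|))); last first.
  by rewrite ler_wpM2l ?ler_expR// ltW.
elim: n => [|n IHn]; first by rewrite big_geq// expR0 mulr1.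
rewrite big_nat_recr//= addrC expRD mulrA (le_trans IHn)// ler_wpM2r ?expR_ge0//.
set q := u n / u n.+1 - 1.
have -> : u n = (1 + q) * u n.+1 by rewrite addrC subrK divfK// gt_eqF.
rewrite mulrC ler_pM2l//.
by apply: le_trans (expR_ge1Dx _); rewrite lerD2l ler_norm.
Qed.

(** * The l1 norm of row vectors and its contraction by stochastic matrices *)

Definition l1norm {R : realType} {N : nat} (z : 'rV[R]_N) : R := \sum_j `|z 0 j|.

Lemma l1norm_ge0 (R : realType) (N : nat) (z : 'rV[R]_N) : 0 <= l1norm z.
Proof. exact: sumr_ge0. Qed.

Lemma l1normD (R : realType) (N : nat) (y z : 'rV[R]_N) :
  l1norm (y + z) <= l1norm y + l1norm z.
Proof.
by rewrite /l1norm -big_split/=; apply: ler_sum => j _; rewrite mxE ler_normD.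
Qed.

Lemma ler_l1norm (R : realType) (N : nat) (z : 'rV[R]_N) j : `|z 0 j| <= l1norm z.
Proof. by rewrite /l1norm (bigD1 j)//= lerDl sumr_ge0. Qed.

Lemma l1norm_eq0 (R : realType) (N : nat) (z : 'rV[R]_N) : l1norm z <= 0 -> z = 0.
Proof.
move=> z0; apply/rowP => j; rewrite mxE; apply/eqP.
by rewrite -normr_eq0 eq_le normr_ge0 (le_trans (ler_l1norm z j)).
Qed.

Lemma sum_mulmx_stochastic (R : realType) (N : nat) (A : 'M[R]_N) (z : 'rV[R]_N) :
  stochastic A -> \sum_j (z *m A) 0 j = \sum_j z 0 j.
Proof.
move=> As; under eq_bigr do rewrite mxE.
by rewrite exchange_big/=; apply: eq_bigr => i _; rewrite -mulr_sumr As mulr1.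
Qed.

(* Split A = (A - d J) + d J, where J is the all-ones matrix; the first summand is
   nonnegative with row sums 1 - N d, and z J depends only on the sum of z. *)
Lemma l1norm_mulmx (R : realType) (N : nat) (d : R) (A : 'M[R]_N) (z : 'rV[R]_N) :
  0 <= d -> stochastic A -> (forall i j, d <= A i j) ->
  l1norm (z *m A) <= (1 - d *+ N) * l1norm z + d *+ N * `|\sum_j z 0 j|.
Proof.
move=> d0 As dA.
apply: (@le_trans _ _ (\sum_j (\sum_i `|z 0 i| * (A i j - d) + d * `|\sum_i z 0 i|))).
  apply: ler_sum => j _.
  have -> : (z *m A) 0 j = \sum_i z 0 i * (A i j - d) + d * \sum_i z 0 i.
    rewrite mxE mulr_sumr -big_split/=; apply: eq_bigr => i _.
    by rewrite mulrBr mulrC [d * _]mulrC subrK mulrC.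
  rewrite (le_trans (ler_normD _ _))// lerD//; last by rewrite normrM ger0_norm.
  rewrite (le_trans (ler_norm_sum _ _ _))//; apply: ler_sum => i _.
  by rewrite normrM [`|A i j - d|]ger0_norm// subr_ge0.
rewrite big_split/= sumr_const card_ord -mulrnAl lerD2r exchange_big/=.
rewrite /l1norm mulr_sumr le_eqVlt; apply/orP; left; apply/eqP.
apply: eq_bigr => i _; rewrite -mulr_sumr mulrC; congr (_ * _).
by rewrite sumrB As sumr_const card_ord.
Qed.

(** This makes the contraction factor [1 - d *+ N] nonnegative. *)
Lemma stochastic_minorant (R : realType) (N : nat) (d : R) (A : 'M[R]_N) :
  (0 < N)%N -> stochastic A -> (forall i j, d <= A i j) -> d *+ N <= 1.
Proof.
move=> N0 As dA; rewrite -(As (Ordinal N0)) -[X in _ *+ X]card_ord -sumr_const.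
exact: ler_sum.
Qed.

(** * Existence and uniqueness of the Perron vector *)

Lemma stochastic_fix_sum0 (R : realType) (N : nat) (A : 'M[R]_N) (d : R)
    (z : 'rV[R]_N) :
  (0 < N)%N -> 0 < d -> stochastic A -> (forall i j, d <= A i j) ->
  z *m A = z -> \sum_j z 0 j = 0 -> z = 0.
Proof.
move=> N0 d0 As dA zA sz; apply: l1norm_eq0.
(* For a fixed vector of sum 0 the bound reads [l1norm z <= (1 - d *+ N) * l1norm z], which forces
   [l1norm z <= 0]. *)
have := l1norm_mulmx z (ltW d0) As dA.
rewrite zA sz normr0 mulr0 addr0 mulrBl mul1r lerBrDl gerDr.
by rewrite pmulr_rle0// pmulrn_lgt0.
Qed.

Lemma perron_vector_uniq (R : realType) (N : nat) (A : 'M[R]_N) (d : R)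
    (v w : 'rV[R]_N) :
  (0 < N)%N -> 0 < d -> stochastic A -> (forall i j, d <= A i j) ->
  perron_vector A v -> perron_vector A w -> w = v.
Proof.
move=> N0 d0 As dA [vA _ v1] [wA _ w1]; apply/eqP; rewrite -subr_eq0; apply/eqP.
apply: (stochastic_fix_sum0 N0 d0 As dA); first by rewrite mulmxBl wA vA.
by under eq_bigr do rewrite !mxE; rewrite sumrB v1 w1 subrr.
Qed.

Lemma perron_vector_exists (R : realType) (N : nat) (A : 'M[R]_N) (d : R) :
  (0 < N)%N -> 0 < d -> stochastic A -> (forall i j, d <= A i j) ->
  exists v, perron_vector A v.
Proof.
move=> N0 d0 As dA.
have dN0 : 0 < d *+ N by rewrite pmulrn_lgt0.
(* Unit row sums say that [A] fixes the all-ones column; the determinant turns this right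
   eigenvector into a left one. *)
have : \det (A - 1%:M) == 0.
  rewrite -det_tr; apply/det0P; exists (const_mx 1).
    apply/eqP => /rowP/(_ (Ordinal N0)) /eqP.
    by rewrite !mxE oner_eq0.
  apply/rowP => i; rewrite !mxE.
  under eq_bigr do rewrite !mxE mul1r.
  rewrite sumrB As (bigD1 i)//= eqxx big1 ?addr0 ?subrr// => j ji.
  by rewrite eq_sym (negbTE ji).
case/det0P => z z0; rewrite mulmxBr mulmx1 => /eqP; rewrite subr_eq0 => /eqP zA.
pose s := \sum_j z 0 j.
(* A nonzero fixed vector cannot have sum 0, so it can be normalised; dividing by [s] also settles
   its sign. *)
have s0 : s != 0.
  apply: contra z0 => /eqP s0; apply/eqP.
  exact: (stochastic_fix_sum0 N0 d0 As dA).
pose v := s^-1 *: z.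
have vA : v *m A = v by rewrite -scalemxAl zA.
have v1 : \sum_j v 0 j = 1.
  by under eq_bigr do rewrite mxE; rewrite -mulr_sumr mulVf.
(* The contraction bound gives l1norm v <= 1 = \sum_j v_j, so v has no negative entry. *)
have lv1 : l1norm v <= 1.
  have := l1norm_mulmx v (ltW d0) As dA; rewrite vA v1 normr1 mulr1.
  by rewrite mulrBl mul1r -addrA -lerBlDl subrr addrC subr_ge0 ger_pMr.
have v_ge0 j : 0 <= v 0 j.
  have nv_ge0 k : xpredT k -> 0 <= `|v 0 k| - v 0 k by rewrite subr_ge0 ler_norm.
  have nv0 : \sum_k (`|v 0 k| - v 0 k) = 0.
    by apply/eqP; rewrite eq_le sumr_ge0// sumrB v1 subr_le0 lv1.
  by rewrite -[v 0 j](subKr `|v 0 j|) (psumr_eq0P nv_ge0 nv0)// subr0.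
exists v; split => // i j; rewrite ord1 -vA mxE.
(* Strict positivity: each entry of [v = v *m A] is at least [d] times the sum of [v], that is, at
   least [d]. *)
apply: (@lt_le_trans _ _ (\sum_i v 0 i * d)).
  by rewrite -mulr_suml v1 mul1r.
by apply: ler_sum => k _; rewrite ler_wpM2l.
Qed.

(** * Convergence of products of stochastic matrices *)

Lemma l1norm_cvg0 (R : realType) (N : nat) (z : nat -> 'rV[R]_N) :
  (forall j, z n 0 j @[n --> \oo] --> 0) -> l1norm (z n) @[n --> \oo] --> 0.
Proof.
move=> z0; suff: l1norm (z n) @[n --> \oo] --> \sum_(j < N) (0 : R) by rewrite big1_eq.
apply: cvg_big => [|j _]; first exact: add_continuous.
by apply/norm_cvg0P/z0.
Qed.

Lemma mulmx_cvg0 (R : realType) (N : nat) (v : 'rV[R]_N) (D : nat -> 'M[R]_N) :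
  mx_cvg D 0 -> forall j, (v *m D n) 0 j @[n --> \oo] --> 0.
Proof.
move=> D0 j.
suff: (v *m D n) 0 j @[n --> \oo] --> \sum_(i < N) (0 : R) by rewrite big1_eq.
under eq_fun do rewrite mxE.
apply: cvg_big => [|i _]; first exact: add_continuous.
rewrite -[X in _ --> X](mulr0 (v 0 i)); apply: cvgMr.
by have := D0 i j; rewrite mxE.
Qed.

Lemma cvg_prod_stochastic (R : realType) (N : nat) (d : R) (T : nat -> 'M[R]_N)
    (A : 'M[R]_N) (v : 'rV[R]_N) :
  (0 < N)%N -> 0 < d -> (forall n, stochastic (T n)) ->
  (forall n i j, d <= T n i j) -> mx_cvg T A -> perron_vector A v ->
  mx_cvg (fun n => \prod_(0 <= k < n) T k) (rows_equal_to v).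
Proof.
move=> N0 d0 Ts dT TA [vA _ v1] i j.
pose r n := row i (\prod_(0 <= k < n) T k).
have rS n : r n.+1 = r n *m T n by rewrite /r big_nat_recr//= -row_mul.
(* Hence [r n - v] has sum 0, and the last term of [l1norm_mulmx] vanishes for it. *)
have r1 n : \sum_j r n 0 j = 1.
  elim: n => [|n IHn]; last by rewrite rS sum_mulmx_stochastic.
  rewrite /r big_geq//; under eq_bigr do rewrite mxE.
  rewrite (bigD1 i)//= mxE eqxx big1 ?addr0// => k ki.
  by rewrite mxE eq_sym (negbTE ki).
have dN0 : 0 < d *+ N by rewrite pmulrn_lgt0.
have c01 : 0 <= 1 - d *+ N < 1.
  by rewrite subr_ge0 gtrBl dN0 (stochastic_minorant N0 (Ts 0%N)).
have TA0 : mx_cvg (fun n => T n - A) 0.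
  move=> k l; rewrite mxE -[0](subrr (A k l)).
  under eq_fun do rewrite !mxE.
  by apply: cvgB; [exact: TA | exact: cvg_cst].
have e0 := l1norm_cvg0 (mulmx_cvg0 v TA0).
have step n : l1norm (r n.+1 - v) <=
    (1 - d *+ N) * l1norm (r n - v) + l1norm (v *m (T n - A)).
  have -> : r n.+1 - v = (r n - v) *m T n + v *m (T n - A).
    by rewrite rS mulmxBl mulmxBr vA addrA subrK.
  rewrite (le_trans (l1normD _ _))// lerD2r.
  rewrite (le_trans (l1norm_mulmx _ (ltW d0) (Ts n) (dT n)))//.
  have -> : \sum_j (r n - v) 0 j = 0.
    by under eq_bigr do rewrite mxE [(- v) _ _]mxE; rewrite sumrB r1 v1 subrr.
  by rewrite normr0 mulr0 addr0.
have rv := contraction_cvg0 c01 (fun n => l1norm_ge0 (r n - v)) step e0.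
rewrite mxE; apply/subr_cvg0/norm_cvg0P.
apply: squeeze_cvgr (cvg_cst 0) rv; apply: nearW => n; rewrite normr_ge0/=.
by rewrite (le_trans _ (ler_l1norm _ j))// !mxE.
Qed.

(** * From summability along words to a bound for each entry *)

Lemma nneseries_bounded (R : realType) (f : nat -> R) :
  (forall n, 0 <= f n) -> (\sum_(1 <= n <oo) (f n)%:E < +oo)%E ->
  exists M, forall m, \sum_(1 <= n < m) f n <= M.
Proof.
move=> f0 fsum; exists (fine (\sum_(1 <= n <oo) (f n)%:E)%E) => m.
have fE n : (1 <= n)%N -> true -> (0 <= (f n)%:E)%E by rewrite lee_fin.
rewrite -lee_fin fineK; last by rewrite ge0_fin_numE// nneseries_ge0.
by rewrite -sumEFin; apply: nneseries_lim_ge.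
Qed.

Lemma entry_sum_bounded (R : realType) (N : nat) (T : nat -> 'M[R]_N) (i j : 'I_N) :
  (forall x : nat -> 'I_N, (\sum_(1 <= n <oo)
     `|T n (x n) (x n.+1) / T n.+1 (x n) (x n.+1) - 1|%:E < +oo)%E) ->
  exists M, forall m, \sum_(1 <= n < m) `|T n i j / T n.+1 i j - 1| <= M.
Proof.
move=> T_sum.
have [M HM] := @nneseries_bounded _ _ (fun=> normr_ge0 _)
  (T_sum (fun n => if odd n then i else j)).
have [M' HM'] := @nneseries_bounded _ _ (fun=> normr_ge0 _)
  (T_sum (fun n => if odd n then j else i)).
exists (M + M') => m; apply: le_trans (lerD (HM m) (HM' m)).
(* The first word reads [i], [j] at odd [n], the second at even [n]; the other word adds a
   nonnegative term. *)
rewrite -big_split/=; apply: ler_sum => n _.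
by case: (odd n); rewrite ?lerDl ?lerDr.
Qed.

(* The sequence T and the words x are indexed from 1; the values T 0 and x 0
   play no role. *)
Theorem proposition3p4 (R : realType) (N : nat) (hN : (2 <= N)%N)
    (T : nat -> 'M[R]_N)
    (T_stoch : forall n, (1 <= n)%N -> stochastic (T n))
    (T_pos : forall n, (1 <= n)%N -> positive_entries (T n))
    (T_sum : forall x : nat -> 'I_N,
      (\sum_(1 <= n <oo)
         `|T n (x n) (x n.+1) / T n.+1 (x n) (x n.+1) - 1|%:E < +oo)%E) :
  exists Tinf : 'M[R]_N,
    [/\ mx_cvg T Tinf, stochastic Tinf, positive_entries Tinf
      & exists v : 'rV[R]_N,
          [/\ perron_vector Tinf v,
              forall w : 'rV[R]_N, perron_vector Tinf w -> w = v
            & forall p : nat, (1 <= p)%N ->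
                mx_cvg (fun n => \prod_(p.+1 <= k < n.+1) T k)
                       (rows_equal_to v)]].
Proof.
have N0 : (0 < N)%N by apply: leq_trans hN.
have T_le1 n i j : 0 < T n.+1 i j <= 1.
  rewrite (T_pos n.+1)//= -(T_stoch n.+1 isT i) (bigD1 j)//= lerDl.
  by apply: sumr_ge0 => k _; rewrite ltW// T_pos.
have entry i j : exists2 d, 0 < d &
    cvgn (fun n => T n.+1 i j) /\ forall n, d <= T n.+1 i j.
  have [M HM] := entry_sum_bounded i j T_sum.
  have [|cT bT] := @cvg_summable_ratio _ (fun n => T n.+1 i j) 1 M (fun n => T_le1 n i j).
    by move=> n; have := HM n.+1; rewrite big_add1.
  exists (T 1%N i j * expR (- M)); last by split.
  by rewrite mulr_gt0 ?expR_gt0// T_pos.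
pose d0 (ij : 'I_N * 'I_N) := projT1 (cid2 (entry ij.1 ij.2)).
pose d := \big[Num.min/1]_ij d0 ij.
(* The minimum runs over finitely many positive bounds, with the positive default value 1. *)
have d_gt0 : 0 < d.
  by apply: lt_bigmin => // ij _; rewrite /d0; case: cid2.
have dT n i j : d <= T n.+1 i j.
  apply: (le_trans (bigmin_le 1 (i, j) d0)).
  by rewrite /d0; case: cid2 => e /= _ [_].
pose A := \matrix_(i, j) lim (T n.+1 i j @[n --> \oo]) : 'M[R]_N.
have TA1 : mx_cvg (fun n => T n.+1) A.
  by move=> i j; rewrite mxE; have [_ _ [cT _]] := entry i j.
have dA i j : d <= A i j.
  rewrite mxE; have [_ _ [cT _]] := entry i j.
  by apply: limr_ge => //; apply: nearW => n; exact: dT.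
have A_stoch : stochastic A.
  move=> i; have : \sum_j T n.+1 i j @[n --> \oo] --> \sum_j A i j.
    by apply: cvg_big => [|j _]; [exact: add_continuous | exact: TA1].
  under eq_fun do rewrite T_stoch//.
  by move=> /cvg_lim <-//; rewrite lim_cst.
have [v vA] := perron_vector_exists N0 d_gt0 A_stoch dA.
exists A; split => //.
- by move=> i j; rewrite -cvg_shiftS; exact: TA1.
- by move=> i j; exact: lt_le_trans (dA i j).
exists v; split => // [w wA|p p1 i j].
  exact: (perron_vector_uniq N0 d_gt0 A_stoch dA vA wA).
have TpA : mx_cvg (fun n => T (n + p.+1)%N) A.
  move=> k l; rewrite (cvg_shiftn p.+1 (fun n => T n k l)).
  by rewrite -cvg_shiftS; exact: TA1.
have prodE n : \prod_(p.+1 <= k < (n + p).+1) T k = \prod_(0 <= k < n) T (k + p.+1)%N.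
  by rewrite -{1}[p.+1]add0n big_addn -addnS addnK.
(* After the shift by [p] the variable [n] counts the factors, so the result for products starting
   at index 0 applies to the shifted sequence. *)
rewrite -(cvg_shiftn p) /=; under eq_fun do rewrite prodE.
apply: (cvg_prod_stochastic N0 d_gt0 _ _ TpA vA) => [n|n k l].
  by apply: T_stoch; rewrite addnS.
by rewrite addnS; exact: dT.
Qed.
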